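(* Let $Q$ be the vehicle capacity and let $S$ be any set of customers whose demands are given by independent Poisson random variables $\xi_i\sim\mathrm{Poisson}(\lambda_i)$, $i\in S$, with total expected value $\sum_{i\in S}\lambda_i\le Q$. Then $S$ respects the monotonicity condition.
   Context: There is a finite set of customers with independent random demands $\xi_i$, served by identical vehicles of capacity $Q>0$. Monotonicity condition: a set $S$ of customers respects the monotonicity condition (with respect to the capacity $Q$) if, for every pair $(a,b)\in S\times S$ with $a\ne b$ and every subset $\tilde S\subseteq S\setminus\{a,b\}$, the inequality $$\mathbb{P}\left(\tilde\xi+\xi_a\le lQ<\tilde\xi+\xi_a+\xi_b\right)\ \ge\ \mathbb{P}\left(\tilde\xi\le lQ<\tilde\xi+\xi_b\right),\qquad \tilde\xi=\sum_{i\in\tilde S}\xi_i,$$ holds for every positive integer $l$.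
   Formalization: The vehicle capacity Q is assumed to be a positive integer; for non-integer Q the claim is false (e.g. Q = 0.9, two customers with rates 0.45, l = 1, empty subset). *)

(* Defs.v *)
From HB Require Import structures.
From mathcomp Require Import all_boot all_order all_algebra.
From mathcomp Require Import all_classical all_reals all_analysis.

Set Implicit Arguments.
Unset Strict Implicit.
Unset Printing Implicit Defensive.

Import Order.TTheory GRing.Theory Num.Theory.

Local Open Scope classical_set_scope.
Local Open Scope ring_scope.

Section Demands.
Context {d : measure_display} {T : measurableType d} {R : realType}.
Variables (P : probability T R) (I : finType).
Implicit Types (xi : I -> {RV P >-> R}) (S : {set I}).

(* Mutual independence of the subfamily (xi i), i in S: the product rule over
   every subfamily J of S.  Nothing is required of xi outside S. *)
Definition mutually_independent xi S : Prop :=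
  forall (J : {set I}) (A : I -> set R), J \subset S ->
    (forall i, i \in J -> measurable (A i)) ->
    P (\bigcap_(i in [set` J]) (xi i @^-1` A i)) =
      (\prod_(i in J) P (xi i @^-1` A i))%E.

(* The probabilities at the natural numbers sum to 1, so this determines the
   law of the real-valued X.  [poisson_pmf] is the usual mass function only for
   a positive rate. *)
Definition poisson_distributed (X : {RV P >-> R}) (lambda : R) : Prop :=
  0 < lambda /\ forall k : nat, pmf X k%:R = poisson_pmf lambda k.

Definition total_demand xi S (w : T) : R := \sum_(i in S) xi i w.

Definition monotonicity_condition (Q : R) xi S : Prop :=
  forall a b : I, a \in S -> b \in S -> a != b ->
  forall S' : {set I}, S' \subset S :\: [set a; b]%SET ->
  forall l : nat, (0 < l)%N ->
    (P [set w | (total_demand xi S' w + xi a w <= l%:R * Q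
                   < total_demand xi S' w + xi a w + xi b w)%R]
     >= P [set w | (total_demand xi S' w <= l%:R * Q
                      < total_demand xi S' w + xi b w)%R])%E.

End Demands.

(* Main.v *)
(* By independence the total demand of a set J of customers is Poisson with rate
   the sum of the rates over J.  If F(m) is the probability that a Poisson
   variable of rate m is at most N = lQ, and demands are almost surely
   nonnegative, then the claim reads
     F(m + a) - F(m + a + b) >= F(m) - F(m + b).
   Since F'(m) = - m^N e^{-m} / N!, and m^N e^{-m} increases on [0, N], the
   left-hand side increases with a as long as m + a + b <= N. *)
Require Import Defs.
From mathcomp Require Import all_boot all_order all_algebra ring lra.
From mathcomp Require Import all_classical all_reals all_analysis.

Set Implicit Arguments.
Unset Strict Implicit.
Unset Printing Implicit Defensive.

Import Order.TTheory GRing.Theory Num.Theory.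
Import numFieldNormedType.Exports.

Local Open Scope classical_set_scope.
Local Open Scope ring_scope.

(** * Poisson masses and distribution functions, as functions of the rate *)

Section PoissonWeights.
Context {R : realType}.
Implicit Types (m x y u v : R) (k n N : nat).

(* Unlike [poisson_pmf], also correct at rate 0: the Dirac mass at 0. *)
Definition poisson_weight m k : R := m ^+ k / k`!%:R * expR (- m).

Definition poisson_cdf N m : R := \sum_(k < N.+1) poisson_weight m k.

Lemma poisson_weightE m k : 0 < m -> poisson_pmf m k = poisson_weight m k.
Proof. by move=> m0; rewrite /poisson_pmf m0. Qed.

Lemma poisson_weight_ge0 m k : 0 <= m -> 0 <= poisson_weight m k.
Proof. by move=> m0; rewrite mulr_ge0 ?expR_ge0// divr_ge0// exprn_ge0. Qed.

Lemma poisson_weight0 k : poisson_weight 0 k = (k == 0)%:R.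
Proof.
by rewrite /poisson_weight oppr0 expR0 mulr1 expr0n; case: k => [|k];
  rewrite ?mul0r// fact0 divr1.
Qed.

(** Binomial theorem, with ['C(k, i) / k!] equal to [1 / (i! (k - i)!)]. This convolution identity
    makes rates add up when customers are pooled. *)
Lemma poisson_weightD u v k :
  \sum_(i < k.+1) poisson_weight u i * poisson_weight v (k - i) =
  poisson_weight (u + v) k.
Proof.
rewrite /poisson_weight opprD expRD addrC exprDn !mulr_suml.
apply: eq_bigr => i _; have ik : (i <= k)%N by rewrite -ltnS.
have fact_neq0 n : n`!%:R != 0 :> R by rewrite pnatr_eq0 -lt0n fact_gt0.
have -> : k`!%:R = ('C(k, i))%:R * (i`!%:R * (k - i)`!%:R) :> R.
  by rewrite -!natrM bin_fact.
have bin_neq0 : ('C(k, i))%:R != 0 :> R by rewrite pnatr_eq0 -lt0n bin_gt0.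
rewrite -mulr_natl; field.
by rewrite bin_neq0 !fact_neq0.
Qed.

Lemma is_derive_poisson_weight0 m :
  is_derive m 1 (poisson_weight ^~ 0%N) (- poisson_weight m 0).
Proof.
have -> : poisson_weight ^~ 0%N = expR \o -%R.
  by apply/funext => x; rewrite /poisson_weight/= expr0 fact0 divr1 mul1r.
apply: is_derive_eq.
by rewrite /poisson_weight expr0 fact0 divr1 mul1r mulrN1.
Qed.

Lemma is_derive_poisson_weightS m k :
  is_derive m 1 (poisson_weight ^~ k.+1)
    (poisson_weight m k - poisson_weight m k.+1).
Proof.
(* Factored into functions with known derivatives, so that instance inference finds the derivative
   of the product. *)
rewrite (_ : poisson_weight ^~ k.+1 =
    (k.+1`!%:R^-1 \*: (id ^+ k.+1)) * (expR \o -%R)); last first.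
  by apply/funext => x; rewrite /poisson_weight !fctE /= [_ / _]mulrC.
apply: is_derive_eq.
rewrite /poisson_weight /GRing.scale/= factS natrM.
have kfact_neq0 : k`!%:R != 0 :> R by rewrite pnatr_eq0 -lt0n fact_gt0.
have kS_neq0 : k.+1%:R != 0 :> R by rewrite pnatr_eq0.
rewrite !fctE /GRing.scale/= exprS.
field.
by rewrite kfact_neq0 addrC natr1 kS_neq0.
Qed.

(** Termwise differentiation telescopes: the positive part of each derivative cancels the negative
    part of the previous one, and only the last negative term survives. *)
Lemma is_derive_poisson_cdf N m :
  is_derive m 1 (poisson_cdf N) (- poisson_weight m N).
Proof.
elim: N => [|N IH].
  rewrite (_ : poisson_cdf 0 = poisson_weight ^~ 0%N).
    exact: is_derive_poisson_weight0.
  by apply/funext => x; rewrite /poisson_cdf big_ord1.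
have -> : poisson_cdf N.+1 = poisson_cdf N + (poisson_weight ^~ N.+1).
  by apply/funext => x; rewrite /poisson_cdf big_ord_recr.
have := is_derive_poisson_weightS m N => dS.
by apply: is_derive_eq; rewrite addrA addNr add0r.
Qed.

(* [(x / y) ^+ N <= expR (N (x / y - 1)) <= expR (x - y)] when [x <= y <= N]. *)
Lemma le_poisson_weight N x y : 0 <= x -> x <= y -> y <= N%:R ->
  poisson_weight x N <= poisson_weight y N.
Proof.
move=> x0 xy yN; have [y0|y0] := leP y 0.
  by have -> : x = y by apply/le_anti; rewrite xy (le_trans y0).
have yn0 : y != 0 by rewrite gt_eqF.
have quotient : (x / y) ^+ N <= expR (x - y).
  apply: (@le_trans _ _ (expR (x / y - 1) ^+ N)).
    rewrite lerXn2r ?nnegrE ?expR_ge0 ?divr_ge0 ?(ltW y0)//.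
    by rewrite -[leLHS](subrKC 1) expR_ge1Dx.
  rewrite -expRM_natl ler_expR.
  have -> : x - y = y * (x / y - 1) by field.
  by rewrite ler_wnM2r// subr_le0 ler_pdivrMr ?mul1r.
rewrite /poisson_weight -!(mulrAC _ (expR _)) ler_pM2r ?invr_gt0 ?ltr0n ?fact_gt0//.
have -> : x ^+ N = (x / y) ^+ N * y ^+ N by rewrite -exprMn divfK.
rewrite mulrAC mulrC ler_pM2l ?exprn_gt0//.
rewrite (le_trans (ler_wpM2r (expR_ge0 _) quotient))// -expRD.
by rewrite addrAC subrr add0r.
Qed.

(* The derivative in [a] of the right-hand side is
   [poisson_weight (m + a + b) N - poisson_weight (m + a) N]. *)
Lemma le_poisson_cdf_increment N m (a b : R) :
  0 <= m -> 0 <= a -> 0 <= b -> m + a + b <= N%:R ->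
  poisson_cdf N m - poisson_cdf N (m + b) <=
  poisson_cdf N (m + a) - poisson_cdf N (m + a + b).
Proof.
move=> m0 a0 b0 mabN.
(* [h t] is the drop of the distribution function from rate [m + t] to [m + t + b]. The claim is
   [h 0 <= h a], obtained from the mean value theorem and the sign of the derivative. *)
pose h : R -> R := (poisson_cdf N \o shift m) - (poisson_cdf N \o shift (m + b)).
have dh (t : R) : is_derive t 1 h
    (poisson_weight (m + t + b) N - poisson_weight (m + t) N).
  have d1 := is_derive_poisson_cdf N (shift m t).
  have d2 := is_derive_poisson_cdf N (shift (m + b) t).
  apply: is_derive_eq.
  rewrite /shift/= /GRing.scale/= addr0 !mulr1 opprK addrC.
  by congr (poisson_weight _ _ - poisson_weight _ _); ring.
have ch : {within `[0, a], continuous h}.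
  apply: continuous_subspaceT => t; apply: differentiable_continuous.
  by apply/derivable1_diffP; apply: ex_derive.
have [c /[!in_itv]/= /andP[c0 ca]] := MVT_segment a0 (fun t _ => dh t) ch.
rewrite /h !fctE/= subr0 !add0r !(addrC a) => hE.
rewrite -subr_ge0.
have -> : m + a + b = m + b + a by ring.
(* As [c] is below [a], the rate [m + c + b] stays below [N], the range where the weight at [N]
   increases with the rate. *)
rewrite hE mulr_ge0// subr_ge0 le_poisson_weight//; lra.
Qed.

End PoissonWeights.

(** * Law of the total demand of a set of customers, and crossing probabilities *)

Section Probabilities.
Context {d : measure_display} {T : measurableType d} {R : realType}.
Context (P : probability T R).

(** The complement of [G] is null, so only the traces on [G] count. This serves to discard outcomes
    with a demand outside the natural numbers. *)
Lemma eq_measure_on_full (G E F : set T) : measurable G -> P G = 1%E ->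
  measurable E -> measurable F -> E `&` G = F `&` G -> P E = P F.
Proof.
move=> mG G1 mE mF EF.
have PGC : P (~` G) = 0%E by rewrite probability_setC// G1 subee.
have PI H : measurable H -> P H = P (H `&` G).
  move=> mH; rewrite (measureDI P mH mG).
  rewrite -[RHS]add0e; congr (_ + _)%E.
  apply: (@subset_measure0 _ _ _ _ _ (~` G)).
  - exact: measurableD.
  - exact: measurableC.
  - by move=> w [].
  - exact: PGC.
by rewrite PI// EF -PI.
Qed.

Context (I : finType) (xi : I -> {RV P >-> R}) (lambda : I -> R) (S : {set I}).
Context (indep : mutually_independent xi S).
Context (poisson : forall i, i \in S -> poisson_distributed (xi i) (lambda i)).
Implicit Types (J K : {set I}) (A : I -> set R).

Let mtotal J : measurable_fun setT (total_demand xi J).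
Proof.
rewrite (_ : total_demand xi J = fun w => \sum_(i <- enum J) xi i w).
  by apply: measurable_sum => i; exact: measurable_funP.
by apply/funext => w; rewrite big_enum.
Qed.

Let mtotal_preimage J B : measurable B -> measurable (total_demand xi J @^-1` B).
Proof. by move=> mB; rewrite -[X in measurable X]setTI; exact: mtotal. Qed.

Let mtotal_le J x : measurable [set w | total_demand xi J w <= x].
Proof.
have -> : [set w | total_demand xi J w <= x] = total_demand xi J @^-1` `]-oo, x].
  by apply/seteqP; split=> w /=; rewrite in_itv.
exact: mtotal_preimage.
Qed.

Let mpreimage i B : measurable B -> measurable (xi i @^-1` B).
Proof. by move=> mB; rewrite -[X in measurable X]setTI; exact: measurable_funP. Qed.

Let mpreimages K A : (forall i, i \in K -> measurable (A i)) ->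
  measurable (\bigcap_(i in [set` K]) (xi i @^-1` A i)).
Proof.
move=> mA; apply: fin_bigcap_measurable => // i iK.
by apply: mpreimage; exact: mA.
Qed.

Lemma measure_poisson_eq i k : i \in S ->
  P (xi i @^-1` [set k%:R]) = (poisson_weight (lambda i) k)%:E.
Proof.
move=> iS; have [l0 /(_ k)] := poisson iS.
by rewrite poisson_weightE// /pmf => <-; rewrite fineK// fin_num_measure.
Qed.

Let natR : set R := range (fun k : nat => k%:R).

Let mnatR : measurable natR.
Proof.
have -> : natR = \bigcup_k [set k%:R] by rewrite /natR -bigcup_imset1.
exact: bigcup_measurable.
Qed.

Lemma measure_poisson_nat i : i \in S -> P (xi i @^-1` natR) = 1%E.
Proof.
move=> iS; have [l0 _] := poisson iS.
have -> : natR = \bigcup_k [set k%:R] by rewrite /natR -bigcup_imset1.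
rewrite preimage_bigcup measure_bigcup; last 2 first.
- by move=> k _; exact: mpreimage.
- move=> j k _ _ [w [/= ->]] /eqP.
  by rewrite eqr_nat => /eqP.
(* The Poisson masses sum to 1 because they form the probability measure [poisson_prob]: 1 is
   replaced by its total mass, which unfolds to the same series. *)
rewrite -(@probability_setT _ _ _ (poisson_prob (lambda i) 0)).
rewrite /= /poisson_prob l0 -nneseries_esumT; last first.
  by move=> *; rewrite lee_fin poisson_pmf_ge0.
rewrite (@eq_eseriesl _ _ predT); last by move=> k; rewrite in_setT.
apply: eq_eseriesr => k _.
by rewrite poisson_weightE// measure_poisson_eq.
Qed.

(** Demands are natural numbers, hence nonnegative, only almost surely; the event identities below
    are checked on this event. *)
Let nat_valued : set T := \bigcap_(i in [set` S]) (xi i @^-1` natR).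

Let mnat_valued : measurable nat_valued.
Proof. exact: mpreimages. Qed.

Let measure_nat_valued : P nat_valued = 1%E.
Proof.
rewrite /nat_valued indep//; apply: big1 => i iS.
exact: measure_poisson_nat.
Qed.

Let total_demand_nat J w : J \subset S -> nat_valued w ->
  exists k : nat, total_demand xi J w = k%:R.
Proof.
move=> JS Sw; apply: (big_ind (fun x => exists k : nat, x = k%:R)).
- by exists 0%N.
- by move=> _ _ [m ->] [n ->]; exists (m + n)%N; rewrite natrD.
- by move=> i iJ; have [k _ <-] := Sw i (fintype.subsetP JS i iJ); exists k.
Qed.

Lemma total_demandU1 j J w : j \notin J ->
  total_demand xi (j |: J)%SET w = xi j w + total_demand xi J w.
Proof. by move=> jJ; rewrite /total_demand big_setU1. Qed.

(* The factor over K is what makes the induction on J go through: it absorbs the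
   event that fixes the value of the summand removed from J. *)
Lemma joint_law_total_demand J K A k : J \subset S -> K \subset S ->
  {in J, forall i, i \notin K} -> (forall i, i \in K -> measurable (A i)) ->
  P ((total_demand xi J @^-1` [set k%:R]) `&`
     \bigcap_(i in [set` K]) (xi i @^-1` A i)) =
  ((poisson_weight (\sum_(i in J) lambda i) k)%:E *
    \prod_(i in K) P (xi i @^-1` A i))%E.
Proof.
move En : #|J| => n.
elim: n J K A k En => [|n IH] J K A k En JS KS JK mA.
  (* Base case: the empty sum is constantly 0, whose law is the Dirac mass given by the weight at
     rate 0; independence over [K] supplies the product. *)
  have -> : J = finset.set0 by apply/eqP; rewrite -cards_eq0 En.
  rewrite big_set0 poisson_weight0 -indep//.
  have -> : total_demand xi finset.set0 @^-1` [set k%:R] =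
      if k == 0%N then [set: T] else set0.
    apply/seteqP; split=> w; rewrite /total_demand/= big_set0.
      by case: k => [//|k] /esym/eqP; rewrite pnatr_eq0.
    by case: k.
  by case: eqP => _; rewrite ?setTI ?set0I ?measure0 ?mul1e ?mul0e.
have [j jJ] : exists j, j \in J by apply/set0Pn; rewrite -card_gt0 En.
pose J' := (J :\ j)%SET.
have J'S : J' \subset S by apply: fintype.subset_trans JS; exact: subsetDl.
have jS : j \in S := fintype.subsetP JS j jJ.
have jK : j \notin K := JK j jJ.
have jJ' : j \notin J' by rewrite !inE eqxx.
have EJ : J = (j |: J')%SET by rewrite finset.setD1K.
have cJ' : #|J'| = n by move: En; rewrite (cardsD1 j) jJ => -[].
pose K' := (j |: K)%SET.
have K'S : K' \subset S by rewrite finset.subUset finset.sub1set jS KS.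
have J'K' : {in J', forall i, i \notin K'}.
  by move=> i; rewrite !inE negb_or => /andP[-> /JK].
(* Customer [j] moves from the sum to the constrained family, with its demand fixed at [m]. *)
pose A' (m : nat) i := if i == j then [set m%:R] else A i.
have mA' m i : i \in K' -> measurable (A' m i).
  rewrite /A' !inE; case: eqVneq => //= _; exact: mA.
pose E (m : nat) := (total_demand xi J' @^-1` [set (k - m)%:R]) `&`
  \bigcap_(i in [set` K']) (xi i @^-1` A' m i).
have mE m : measurable (E m).
  by apply: measurableI; [exact: mtotal_preimage | exact: mpreimages (mA' m)].
have Exi m w : E m w -> xi j w = m%:R.
  by move=> [_ /(_ j)]; rewrite /= !inE eqxx /A' eqxx; exact.
have tE : trivIset setT (fun m : 'I_k.+1 => E m).
  move=> m m' _ _ [w [/Exi xm /Exi]]; rewrite xm => /eqP.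
  by rewrite eqr_nat => /eqP /val_inj.
(* Up to a null event, the event splits into disjoint slices according to the demand [m] of [j].
   Since [m] is at most [k], the subtraction [k - m] is never truncated. *)
transitivity (P (\big[setU/set0]_(m < k.+1) E m)).
  apply: (eq_measure_on_full mnat_valued measure_nat_valued).
  - by apply: measurableI; [exact: mtotal_preimage | exact: mpreimages].
  - by apply: bigsetU_measurable.
  rewrite -(bigcup_mkord _ E); apply/seteqP; split=> w [] /=.
    move=> [tk Kw] Sw; split=> //.
    have [m _ xm] := Sw j jS; have [m' tm'] := total_demand_nat J'S Sw.
    move: tk; rewrite EJ total_demandU1// -xm tm' -natrD => /eqP.
    rewrite eqr_nat => /eqP km.
    exists m; first by rewrite /= ltnS -km leq_addr.
    split; first by rewrite /= tm' -km addKn.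
    move=> i /=; rewrite !inE /A'; case: eqVneq => /= [-> _|_ iK]; first by rewrite xm.
    exact: Kw.
  move=> [m /= mk Ew] Sw; split=> //; split.
    rewrite EJ total_demandU1// (Exi _ _ Ew); case: Ew => /= -> _.
    by rewrite -natrD subnKC.
  move=> i /= iK; case: Ew => _ /(_ i).
  rewrite /= !inE iK orbT /A' => /(_ isT); case: eqVneq => // ij.
  by move: jK; rewrite -ij iK.
rewrite measure_bigsetU_ord//.
rewrite EJ big_setU1//= -poisson_weightD.
rewrite -sumEFin ge0_sume_distrl; last first.
  move=> m _; rewrite lee_fin mulr_ge0// poisson_weight_ge0//.
    by have [/ltW] := poisson jS.
  by apply: sumr_ge0 => i /(fintype.subsetP J'S) /poisson[/ltW].
apply: eq_bigr => m _.
(* The induction hypothesis for [J'] and [K'] leaves a product over [K'], whose factor at [j] is the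
   Poisson mass at [m]. *)
rewrite IH//; last exact: mA'.
rewrite big_setU1//= {1}/A' eqxx measure_poisson_eq//.
rewrite muleA -EFinM mulrC; congr (_ * _)%E.
apply: eq_bigr => i iK; rewrite /A'; case: eqVneq => // ij.
by move: jK; rewrite -ij iK.
Qed.

Lemma cdf_total_demand J N : J \subset S ->
  P [set w | total_demand xi J w <= N%:R] =
  (poisson_cdf N (\sum_(i in J) lambda i))%:E.
Proof.
move=> JS; pose E (k : nat) := total_demand xi J @^-1` [set k%:R].
have law k : P (E k) = (poisson_weight (\sum_(i in J) lambda i) k)%:E.
  (* An empty constrained family gives the law of the total demand alone. *)
  have := @joint_law_total_demand J finset.set0 (fun=> setT) k JS (finset.sub0set _).
  rewrite big_set0 mule1 => <- //; last by move=> i; rewrite inE.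
  congr (P _); apply/seteqP; split=> w /=; last by case.
  by move=> Ew; split=> // i /=; rewrite inE.
have tE : trivIset setT (fun k : 'I_N.+1 => E k).
  move=> m m' _ _ [w []]; rewrite /E/= => -> /eqP.
  by rewrite eqr_nat => /eqP /val_inj.
have mE k : measurable (E k) by exact: mtotal_preimage.
rewrite /poisson_cdf -sumEFin; under [RHS]eq_bigr do rewrite -law.
rewrite -measure_bigsetU_ord//.
apply: (eq_measure_on_full mnat_valued measure_nat_valued).
- exact: mtotal_le.
- exact: bigsetU_measurable.
rewrite -(bigcup_mkord _ E); apply/seteqP; split=> w [] /=.
  move=> tN Sw; split=> //; have [k tk] := total_demand_nat JS Sw.
  by exists k => //=; rewrite ltnS -(ler_nat R) -tk.
by move=> [k /= kN ->] Sw; split=> //; rewrite ler_nat.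
Qed.

(** Crossing means that [J] stays within [N] but [J] with [j] does not. As the demand of [j] is
    almost surely nonnegative, the second event [Y] is almost surely contained in the first event
    [X], and the probabilities subtract. *)
Lemma crossing_probability J j N : J \subset S -> j \in S -> j \notin J ->
  P [set w | (total_demand xi J w <= N%:R < total_demand xi J w + xi j w)%R] =
  (poisson_cdf N (\sum_(i in J) lambda i) -
   poisson_cdf N (\sum_(i in J) lambda i + lambda j))%:E.
Proof.
move=> JS jS jJ.
have jJS : (j |: J)%SET \subset S by rewrite finset.subUset finset.sub1set jS.
pose X := [set w | total_demand xi J w <= N%:R].
pose Y := [set w | total_demand xi (j |: J)%SET w <= N%:R].
have -> : [set w | (total_demand xi J w <= N%:R < total_demand xi J w + xi j w)%R]
    = X `\` Y.
  apply/seteqP; split=> w; rewrite /X /Y/= total_demandU1// addrC.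
    by move=> /andP[-> lt]; split=> //; apply/negP; rewrite -ltNge.
  by move=> [-> /negP]; rewrite -ltNge.
have PXY : P (X `&` Y) = P Y.
  apply: (eq_measure_on_full mnat_valued measure_nat_valued).
  - by apply: measurableI; exact: mtotal_le.
  - exact: mtotal_le.
  apply/seteqP; split=> w; rewrite /X /Y/= => -[]; first by case.
  move=> Yw Sw; split=> //; split=> //.
  apply: le_trans Yw; rewrite total_demandU1// lerDr.
  by have [k _ <-] := Sw j jS.
transitivity (P X - P Y)%E.
  rewrite measureD; first by congr (_ - _)%E; exact: PXY.
  - exact: mtotal_le.
  - exact: mtotal_le.
  - exact: le_lt_trans (probability_le1 P (mtotal_le J N%:R)) (ltry _).
by rewrite !cdf_total_demand// big_setU1//= [lambda j + _]addrC.
Qed.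

End Probabilities.

(* Capacities are measured in the same integer unit as Poisson demands; for a
   non-integer Q the claim fails (e.g. Q = 9/10, l = 1, S' empty). *)
Theorem proposition4 (d : measure_display) (T : measurableType d)
    (R : realType) (P : probability T R) (I : finType)
    (Q : R) (xi : I -> {RV P >-> R}) (lambda : I -> R) (S : {set I}) :
  0 < Q -> Q \is a Num.nat ->
  mutually_independent xi S ->
  (forall i, i \in S -> poisson_distributed (xi i) (lambda i)) ->
  \sum_(i in S) lambda i <= Q ->
  monotonicity_condition Q xi S.
Proof.
move=> Q0 /natrP[q Qq] indep poisson lambdaQ a b aS bS ab S' S'ab l l0.
have S'S : S' \subset S.
  by apply: fintype.subset_trans S'ab _; exact: finset.subsetDl.
have aS' : a \notin S'.
  by apply: contraL S'ab => aS'; apply/subsetPn; exists a; rewrite ?inE ?eqxx.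
have bS' : b \notin S'.
  by apply: contraL S'ab => bS'; apply/subsetPn; exists b; rewrite ?inE ?eqxx ?orbT.
have baS' : b \notin (a |: S')%SET by rewrite !inE negb_or eq_sym ab.
have aS'S : (a |: S')%SET \subset S by rewrite finset.subUset finset.sub1set aS.
have lambda0 i : i \in S -> 0 <= lambda i by move=> /poisson[/ltW].
(* The threshold [l * Q] becomes the natural number [l * q], as the distribution function
   requires. *)
rewrite Qq -natrM.
rewrite (crossing_probability indep poisson _ S'S bS bS').
(* Customer [a] is absorbed into the set, so that the same crossing formula applies to [S'] with [a]
   added. *)
under eq_set do rewrite [total_demand xi S' _ + xi a _]addrC -!total_demandU1//.
rewrite (crossing_probability indep poisson _ aS'S bS baS') big_setU1//=.
rewrite [lambda a + _]addrC lee_fin le_poisson_cdf_increment ?lambda0//.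
  by apply: sumr_ge0 => i /(fintype.subsetP S'S) /lambda0.
(* The rates of [S'], [a] and [b] are part of the total over [S], which is at most [Q], hence at
   most [l * Q] because [l] is positive. *)
apply: (@le_trans _ _ (\sum_(i in S) lambda i)).
  have -> : \sum_(i in S') lambda i + lambda a + lambda b =
      \sum_(i in (b |: (a |: S'))%SET) lambda i.
    by rewrite !big_setU1//= addrC [lambda a + _]addrC.
  rewrite [leRHS](big_setID (b |: (a |: S'))%SET)/=.
  have -> : (S :&: (b |: (a |: S')))%SET = (b |: (a |: S'))%SET.
    by apply/finset.setIidPr; rewrite finset.subUset finset.sub1set bS.
  by rewrite lerDl sumr_ge0// => i; rewrite inE => /andP[_ /lambda0].
by rewrite (le_trans lambdaQ)// Qq ler_nat leq_pmull.
Qed.
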